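(* Let $\mathfrak{D}$ be a concrete domain whose domain $D$ is infinite and which satisfies JD. Then the consistency problem for $\mathcal{ALCSCC}^{++}(\mathfrak{D})$ TBoxes is undecidable.
   Context: A concrete domain $\mathfrak{D}=(D,P_1^D,\dots)$ is a relational structure over a countable signature. JD: there is a quantifier-free, equality-free first-order formula $\phi_=(x,y)$ over the signature of $\mathfrak{D}$ defining equality on $D$. Feature roles are $P(\alpha_1,\dots,\alpha_k)$ with $P$ a $k$-ary predicate of $\mathfrak{D}$ and each $\alpha_i$ of the form $f$ or $\partial f$ with $f$ a feature name; in an interpretation, $(d,e)\in P(\alpha_1,\dots,\alpha_k)^\mathcal{I}$ iff $(c_1,\dots,c_k)\in P^D$ where $c_i=f_i^\mathcal{I}(d)$ if $\alpha_i=f_i$ and $c_i=f_i^\mathcal{I}(e)$ if $\alpha_i=\partial f_i$ (features are partial functions into $D$). QFBAPA constraints: set constraints $s\subseteq t$, $s=t$ over set terms built from set variables, $\emptyset$, $\mathcal{U}$ using $\cap,\cup,{}^c$, and numerical constraints $\ell=\ell'$, $\ell<\ell'$, $n\mathrel{\mathsf{div}}\ell$ over PA expressions $n_0+n_1|s_1|+\dots+n_k|s_k|$. $\mathcal{ALCSCC}^{++}(\mathfrak{D})$ concepts are concept names, $\neg C$, $C\sqcap D$, concrete-domain restrictions $\exists p_1,\dots,p_k.P$ ($p_i$ of form $f$ or $rf$), and $\mathsf{sat}(\mathfrak{con})$ where $\mathfrak{con}$ is a set or numerical constraint whose set variables are role names, concepts and feature roles. Interpretations are finite; $d\in\mathsf{sat}(\mathfrak{con})^\mathcal{I}$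 iff $\mathfrak{con}$ is satisfied by the assignment with $\mathcal{U}\mapsto\Delta^\mathcal{I}$, $r\mapsto r^\mathcal{I}(d)=\{e\mid (d,e)\in r^\mathcal{I}\}$, $C\mapsto C^\mathcal{I}$, $\gamma\mapsto\{e\mid(d,e)\in\gamma^\mathcal{I}\}$. A TBox is a finite set of CIs $C\sqsubseteq D$; it is consistent if it has a finite model. *)

(* Defs.v *)
From mathcomp Require Import all_boot.
From mathcomp Require Import boolp classical_sets cardinality.
From mathcomp Require Import finset.

Set Implicit Arguments.
Unset Strict Implicit.
Unset Printing Implicit Defensive.

Record signature := Signature {
  pred_name : countType;
  arity : pred_name -> nat }.

Record concrete_domain := ConcreteDomain {
  cd_sig :> signature;
  cd_dom : Type;
  cd_rel : forall P : pred_name cd_sig, (arity P).-tuple cd_dom -> Prop }.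

Definition infinite_domain (D : concrete_domain) : Prop :=
  infinite_set [set: cd_dom D]%classic.

(* There is no constructor for equality: these are exactly the
   quantifier-free, equality-free formulas with variables in V. *)
Inductive qf_formula (S : signature) (V : Type) : Type :=
| QAtom (P : pred_name S) of (arity P).-tuple V
| QNot of qf_formula S V
| QAnd of qf_formula S V & qf_formula S V
| QOr of qf_formula S V & qf_formula S V.

Fixpoint qf_holds (D : concrete_domain) (V : Type) (v : V -> cd_dom D)
    (phi : qf_formula D V) : Prop :=
  match phi with
  | QAtom P t => cd_rel [tuple of map v t]
  | QNot p => ~ qf_holds v p
  | QAnd p q => qf_holds v p /\ qf_holds v q
  | QOr p q => qf_holds v p \/ qf_holds v q
  end.

(* The variables x and y are the two elements of 'I_2. *)
Definition JD (D : concrete_domain) : Prop :=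
  exists phi : qf_formula D 'I_2,
    forall a b : cd_dom D, qf_holds (tnth [tuple a; b]) phi <-> a = b.

(* Concept, role and feature names are drawn from three disjoint countably
   infinite supplies, each indexed by nat. *)
Definition concept_name := nat.
Definition role_name := nat.
Definition feature_name := nat.

(* FOwn f is f, and FNext f is \partial f. *)
Inductive feature_arg := FOwn of feature_name | FNext of feature_name.

(* PFeat f is the path f, and PRole r f is the path r f. *)
Inductive feature_path :=
  PFeat of feature_name | PRole of role_name & feature_name.

(* PConst and PAdd generate the expressions n_0 + n_1 |s_1| + ... + n_k |s_k|:
   PAdd n s l is n |s| + l. *)
Inductive concept (S : signature) : Type :=
| CName of concept_name
| CNot of concept S
| CAnd of concept S & concept S
| CRestr (P : pred_name S) of (arity P).-tuple feature_path
| CSat of constraint S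
with constraint (S : signature) : Type :=
| KSub of set_term S & set_term S
| KSetEq of set_term S & set_term S
| KEq of pa_expr S & pa_expr S
| KLt of pa_expr S & pa_expr S
| KDvd of nat & pa_expr S
with set_term (S : signature) : Type :=
| TRole of role_name
| TConcept of concept S
| TFeature (P : pred_name S) of (arity P).-tuple feature_arg
| TEmpty
| TUniv
| TCap of set_term S & set_term S
| TCup of set_term S & set_term S
| TCompl of set_term S
with pa_expr (S : signature) : Type :=
| PConst of nat
| PAdd of nat & set_term S & pa_expr S.

Arguments CName {S}.
Arguments CRestr {S}.
Arguments TRole {S}.
Arguments TFeature {S}.
Arguments TEmpty {S}.
Arguments TUniv {S}.
Arguments PConst {S}.

(* The pair (C, E) is the concept inclusion C \sqsubseteq E; the list is read as
   a finite set. *)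
Definition tbox (S : signature) := seq (concept S * concept S).

Record interpretation (D : concrete_domain) := Interpretation {
  idom : finType;
  idom_gt0 : 0 < #|idom|;
  iconcept : concept_name -> {set idom};
  irole : role_name -> rel idom;
  ifeature : feature_name -> idom -> option (cd_dom D) }.

Section Semantics.
Variables (D : concrete_domain) (I : interpretation D).

Definition arg_value (d e : idom I) (a : feature_arg) : option (cd_dom D) :=
  match a with
  | FOwn f => ifeature f d
  | FNext f => ifeature f e
  end.

Definition feature_role (P : pred_name D) (t : (arity P).-tuple feature_arg)
    (d e : idom I) : Prop :=
  exists c : (arity P).-tuple (cd_dom D),
    (forall i, arg_value d e (tnth t i) = Some (tnth c i)) /\ cd_rel c.

Definition path_value (p : feature_path) (d : idom I) (c : cd_dom D) : Prop :=
  match p with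
  | PFeat f => ifeature f d = Some c
  | PRole r f => exists2 e, irole r d e & ifeature f e = Some c
  end.

Definition restriction (P : pred_name D) (t : (arity P).-tuple feature_path)
    (d : idom I) : Prop :=
  exists c : (arity P).-tuple (cd_dom D),
    (forall i, path_value (tnth t i) d (tnth c i)) /\ cd_rel c.

Fixpoint concept_int (C : concept D) : {set idom I} :=
  match C with
  | CName A => iconcept I A
  | CNot C1 => ~: concept_int C1
  | CAnd C1 C2 => concept_int C1 :&: concept_int C2
  | CRestr P t => [set d | `[< restriction t d >]]
  | CSat k => [set d | constraint_sat k d]
  end
with constraint_sat (k : constraint D) (d : idom I) : bool :=
  match k with
  | KSub s t => set_term_val s d \subset set_term_val t d
  | KSetEq s t => set_term_val s d == set_term_val t d
  | KEq l l' => pa_val l d == pa_val l' d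
  | KLt l l' => pa_val l d < pa_val l' d
  | KDvd n l => n %| pa_val l d
  end
with set_term_val (s : set_term D) (d : idom I) : {set idom I} :=
  match s with
  | TRole r => [set e | irole r d e]
  | TConcept C => concept_int C
  | TFeature P t => [set e | `[< feature_role t d e >]]
  | TEmpty => set0
  | TUniv => [set: idom I]
  | TCap s1 s2 => set_term_val s1 d :&: set_term_val s2 d
  | TCup s1 s2 => set_term_val s1 d :|: set_term_val s2 d
  | TCompl s1 => ~: set_term_val s1 d
  end
with pa_val (l : pa_expr D) (d : idom I) : nat :=
  match l with
  | PConst n => n
  | PAdd n s l1 => n * #|set_term_val s d| + pa_val l1 d
  end.

Definition is_model (T : tbox D) : bool :=
  all (fun ci => concept_int ci.1 \subset concept_int ci.2) T.

End Semantics.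

Definition consistent (D : concrete_domain) (T : tbox D) : Prop :=
  exists I : interpretation D, is_model I T.

Inductive recfun : nat -> Type :=
| RZero n : recfun n
| RSucc : recfun 1
| RProj n (i : 'I_n) : recfun n
| RComp n m (f : recfun m) (g : 'I_m -> recfun n) : recfun n
| RPrim n (f : recfun n) (g : recfun n.+2) : recfun n.+1
| RMu n (f : recfun n.+1) : recfun n.

(* The graph of the partial function h defined by h(0) = y if F y, and
   h(k+1) = y if G k (h(k)) y. *)
Fixpoint prim_graph (F : nat -> Prop) (G : nat -> nat -> nat -> Prop)
    (k y : nat) : Prop :=
  match k with
  | 0 => F y
  | k'.+1 => exists2 z, prim_graph F G k' z & G k' z y
  end.

(* rec_eval f v y : the partial function denoted by f is defined at v, with
   value y.  Minimisation requires f to be defined below the least zero. *)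
Fixpoint rec_eval n (f : recfun n) : n.-tuple nat -> nat -> Prop :=
  match f in recfun n return n.-tuple nat -> nat -> Prop with
  | RZero _ => fun _ y => y = 0
  | RSucc => fun v y => y = (thead v).+1
  | RProj _ i => fun v y => y = tnth v i
  | RComp _ m f g => fun v y =>
      exists2 w : m.-tuple nat,
        forall i, rec_eval (g i) v (tnth w i) & rec_eval f w y
  | RPrim _ f g => fun v y =>
      prim_graph (rec_eval f [tuple of behead v])
        (fun k z => rec_eval g [tuple of [:: k, z & behead v]]) (thead v) y
  | RMu _ f => fun v y =>
      rec_eval f [tuple of y :: v] 0 /\
      forall i, i < y -> exists z, rec_eval f [tuple of i :: v] z.+1
  end.

(* A decision procedure need only halt on codes of instances: its behaviour on
   other numbers is unconstrained. *)
Definition undecidable (X : Type) (code : X -> nat) (P : X -> Prop) : Prop :=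
  ~ exists f : recfun 1, forall x : X,
      (P x -> rec_eval f [tuple code x] 1) /\
      (~ P x -> rec_eval f [tuple code x] 0).

(* CodeSeq.code is a computable bijection from seq nat to nat.  A node of the
   syntax tree is coded by the sequence of a tag and the codes of its sons;
   predicate names are coded by pickle. *)
Definition feature_arg_code (a : feature_arg) : nat :=
  match a with
  | FOwn f => CodeSeq.code [:: 0; f]
  | FNext f => CodeSeq.code [:: 1; f]
  end.

Definition feature_path_code (p : feature_path) : nat :=
  match p with
  | PFeat f => CodeSeq.code [:: 0; f]
  | PRole r f => CodeSeq.code [:: 1; r; f]
  end.

Fixpoint concept_code (S : signature) (C : concept S) : nat :=
  match C with
  | CName A => CodeSeq.code [:: 0; A]
  | CNot C1 => CodeSeq.code [:: 1; concept_code C1]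
  | CAnd C1 C2 => CodeSeq.code [:: 2; concept_code C1; concept_code C2]
  | CRestr P t => CodeSeq.code [:: 3, pickle P & map feature_path_code t]
  | CSat k => CodeSeq.code [:: 4; constraint_code k]
  end
with constraint_code (S : signature) (k : constraint S) : nat :=
  match k with
  | KSub s t => CodeSeq.code [:: 0; set_term_code s; set_term_code t]
  | KSetEq s t => CodeSeq.code [:: 1; set_term_code s; set_term_code t]
  | KEq l l' => CodeSeq.code [:: 2; pa_expr_code l; pa_expr_code l']
  | KLt l l' => CodeSeq.code [:: 3; pa_expr_code l; pa_expr_code l']
  | KDvd n l => CodeSeq.code [:: 4; n; pa_expr_code l]
  end
with set_term_code (S : signature) (s : set_term S) : nat :=
  match s with
  | TRole r => CodeSeq.code [:: 0; r]
  | TConcept C => CodeSeq.code [:: 1; concept_code C]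
  | TFeature P t => CodeSeq.code [:: 2, pickle P & map feature_arg_code t]
  | TEmpty => CodeSeq.code [:: 3]
  | TUniv => CodeSeq.code [:: 4]
  | TCap s1 s2 => CodeSeq.code [:: 5; set_term_code s1; set_term_code s2]
  | TCup s1 s2 => CodeSeq.code [:: 6; set_term_code s1; set_term_code s2]
  | TCompl s1 => CodeSeq.code [:: 7; set_term_code s1]
  end
with pa_expr_code (S : signature) (l : pa_expr S) : nat :=
  match l with
  | PConst n => CodeSeq.code [:: 0; n]
  | PAdd n s l1 => CodeSeq.code [:: 1; n; set_term_code s; pa_expr_code l1]
  end.

Definition tbox_code (S : signature) (T : tbox S) : nat :=
  CodeSeq.code
    [seq CodeSeq.code [:: concept_code ci.1; concept_code ci.2] | ci <- T].

Scheme concept_mut := Induction for concept Sort Prop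
with constraint_mut := Induction for constraint Sort Prop
with set_term_mut := Induction for set_term Sort Prop
with pa_expr_mut := Induction for pa_expr Sort Prop.
Combined Scheme syntax_mut from
  concept_mut, constraint_mut, set_term_mut, pa_expr_mut.

Lemma codeseq_inj : injective CodeSeq.code.
Proof. exact: can_inj CodeSeq.codeK. Qed.

Lemma feature_arg_code_inj : injective feature_arg_code.
Proof. by case=> f [] g /codeseq_inj // [->]. Qed.

Lemma feature_path_code_inj : injective feature_path_code.
Proof. by case=> [f|r f] [g|s g] /codeseq_inj // [->] // ->. Qed.

Lemma syntax_code_inj (S : signature) :
  [/\ injective (@concept_code S), injective (@constraint_code S),
      injective (@set_term_code S) & injective (@pa_expr_code S)].
Proof.
have tagI X (c : X -> nat) (P Q : pred_name S) (t : (arity P).-tuple X)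
    (u : (arity Q).-tuple X) : injective c -> pickle P = pickle Q ->
    map c t = map c u -> existT (fun P => (arity P).-tuple X) P t
                       = existT (fun P => (arity P).-tuple X) Q u.
  move=> cI /(pcan_inj pickleK) PQ; case: Q / PQ u => u /(inj_map cI) tu.
  by congr existT; apply: val_inj.
suff [H1 [H2 [H3 H4]]] :
    (forall C C' : concept S, concept_code C = concept_code C' -> C = C') /\
    (forall k k' : constraint S, constraint_code k = constraint_code k' -> k = k') /\
    (forall s s' : set_term S, set_term_code s = set_term_code s' -> s = s') /\
    (forall l l' : pa_expr S, pa_expr_code l = pa_expr_code l' -> l = l') by split.
apply: (@syntax_mut S).
- by move=> A [] > /codeseq_inj // [->].
- by move=> C IH [] > /codeseq_inj // [] /IH ->.
- by move=> C IH E IH' [] > /codeseq_inj // [] /IH -> /IH' ->.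
- move=> P t [] > /codeseq_inj // [] ePQ etu.
  exact: (congr1 (fun x => CRestr (projT1 x) (projT2 x))
                 (tagI _ _ _ _ _ _ feature_path_code_inj ePQ etu)).
- by move=> k IH [] > /codeseq_inj // [] /IH ->.
- by move=> s IH t IH' [] > /codeseq_inj // [] /IH -> /IH' ->.
- by move=> s IH t IH' [] > /codeseq_inj // [] /IH -> /IH' ->.
- by move=> s IH t IH' [] > /codeseq_inj // [] /IH -> /IH' ->.
- by move=> s IH t IH' [] > /codeseq_inj // [] /IH -> /IH' ->.
- by move=> n l IH [] > /codeseq_inj // [] -> /IH ->.
- by move=> r [] > /codeseq_inj // [->].
- by move=> C IH [] > /codeseq_inj // [] /IH ->.
- move=> P t [] > /codeseq_inj // [] ePQ etu.
  exact: (congr1 (fun x => TFeature (projT1 x) (projT2 x))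
                 (tagI _ _ _ _ _ _ feature_arg_code_inj ePQ etu)).
- by move=> [] > /codeseq_inj.
- by move=> [] > /codeseq_inj.
- by move=> s IH t IH' [] > /codeseq_inj // [] /IH -> /IH' ->.
- by move=> s IH t IH' [] > /codeseq_inj // [] /IH -> /IH' ->.
- by move=> s IH [] > /codeseq_inj // [] /IH ->.
- by move=> n [] > /codeseq_inj // [->].
- by move=> n s IH l IH' [] > /codeseq_inj // [] -> /IH -> /IH' ->.
Qed.

Lemma tbox_code_inj (S : signature) : injective (@tbox_code S).
Proof.
have [cI _ _ _] := syntax_code_inj S.
move=> T U /codeseq_inj; apply: inj_map => -[C E] [C' E'] /codeseq_inj /= [].
by move=> /cI -> /cI ->.
Qed.

(* Main.v *)
(* A finite model can carry a derivation tree for [rec_eval h (n) y]: a domain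
   element stands for a fact "f(v) = y" about a subterm f of h.  The i-th number
   occurring in the fact is the number of elements e whose i-th owner feature
   equals the key feature of the fact, and each fact points to its premises by
   features whose values are their keys.  As equality of feature values is
   definable, an element can compare its own numbers with those of its
   premises, so the computation rules become concept inclusions.  Premises may
   form cycles in a model, but this is harmless: each rule passes to a proper
   subterm or decreases a number.

   Given a decider, diagonalise: let h halt on the code of T iff the decider
   rejects T extended by the inclusion "the input is the code of T", and let T
   be the TBox of h.  No universal machine is needed, because prepending an
   inclusion to T is the map c |-> 2 ^ a * (2 * c + 1) on codes. *)

Require Import Defs.
From HB Require Import structures.
From mathcomp Require Import all_boot.
From mathcomp Require Import boolp classical_sets functions cardinality.
From mathcomp Require Import finset.

Set Implicit Arguments.
Unset Strict Implicit.
Unset Printing Implicit Defensive.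

(** * Recursive functions *)

Lemma prim_graph_det (F : nat -> Prop) (G : nat -> nat -> nat -> Prop) :
    (forall y y', F y -> F y' -> y = y') ->
    (forall k z y y', G k z y -> G k z y' -> y = y') ->
  forall k y y', prim_graph F G k y -> prim_graph F G k y' -> y = y'.
Proof.
move=> Fdet Gdet; elim=> [|k IH] y y' /=; first exact: Fdet.
by case=> z /IH zE Gy [z' /zE <-]; apply: Gdet.
Qed.

(** For [RMu], if two results differ, the smaller one is a zero of [f] by its own clause, while the
    clause of the larger one gives [f] a positive value there. *)
Lemma rec_eval_det n (f : recfun n) v y y' :
  rec_eval f v y -> rec_eval f v y' -> y = y'.
Proof.
elim: f v y y' => {n} [n||n i|n m f IHf g IHg|n f IHf g IHg|n f IHf] v y y' /=.
- by move=> -> ->.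
- by move=> -> ->.
- by move=> -> ->.
- case=> w gw fw [w' gw' fw'].
  suff ww' : w = w' by apply: (IHf w) => //; rewrite ww'.
  by apply: eq_from_tnth => i; apply: IHg (gw i) (gw' i).
- by apply: prim_graph_det => *; [apply: IHf|apply: IHg]; eassumption.
- move=> [fy ltf] [fy' ltf']; case: (ltngtP y y') => // [/ltf' | /ltf] [z].
  + by move=> /(IHf _ _ _ fy).
  + by move=> /(IHf _ _ _ fy').
Qed.

Definition computes n (f : recfun n) (F : n.-tuple nat -> nat) :=
  forall v, rec_eval f v (F v).

Definition RComp2 n (f : recfun 2) (a b : recfun n) : recfun n :=
  RComp f (tnth [tuple a; b]).

Lemma RComp2_computes n f (a b : recfun n) F A B :
    (forall x y, rec_eval f [tuple x; y] (F x y)) ->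
    computes a A -> computes b B ->
  computes (RComp2 f a b) (fun v => F (A v) (B v)).
Proof.
move=> fF aA bB v; exists [tuple A v; B v]; last exact: fF.
by case=> -[|[|//]] ?; [apply: aA | apply: bB].
Qed.

Definition RSucc_of n (a : recfun n) : recfun n := RComp RSucc (fun=> a).

Lemma RSucc_of_computes n (a : recfun n) A :
  computes a A -> computes (RSucc_of a) (fun v => (A v).+1).
Proof.
by move=> aA v; exists [tuple A v] => // i; rewrite (ord1 i); apply: aA.
Qed.

Definition RConst n k : recfun n := iter k (@RSucc_of n) (RZero n).

Lemma RConst_computes n k : computes (RConst n k) (fun=> k).
Proof. by elim: k => [|k IH] //=; apply: RSucc_of_computes. Qed.

Lemma RProj_computes n (i : 'I_n) : computes (RProj i) (fun v => tnth v i).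
Proof. by []. Qed.

Definition RDouble : recfun 1 :=
  RPrim (RZero 0) (RSucc_of (RSucc_of (RProj (@Ordinal 2 1 isT)))).

Lemma RDouble_computes : computes RDouble (fun v => (thead v).*2).
Proof.
move=> v; rewrite /RDouble; move: (RSucc_of _) (RSucc_of_computes
  (RSucc_of_computes (RProj_computes (@Ordinal 2 1 isT)))) => g gP /=.
by elim: (thead v) => [|k IH] //=; exists k.*2 => //; apply: gP.
Qed.

Definition RDouble_of n (a : recfun n) : recfun n := RComp RDouble (fun=> a).

Lemma RDouble_of_computes n (a : recfun n) A :
  computes a A -> computes (RDouble_of a) (fun v => (A v).*2).
Proof.
move=> aA v; exists [tuple A v]; last exact: RDouble_computes.
by move=> i; rewrite (ord1 i); apply: aA.
Qed.

(** Recursion on the first argument: start from [2 * y + 1] and double [x] times. This is the list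
    constructor on codes. *)
Definition RCons : recfun 2 :=
  RPrim (RSucc_of (RDouble_of (RProj (@Ordinal 1 0 isT))))
        (RDouble_of (RProj (@Ordinal 3 1 isT))).

Lemma RCons_computes x y : rec_eval RCons [tuple x; y] (2 ^ x * y.*2.+1).
Proof.
rewrite /RCons; move: (RSucc_of _) (RSucc_of_computes
  (RDouble_of_computes (RProj_computes (@Ordinal 1 0 isT)))) => f fP.
move: (RDouble_of _) (RDouble_of_computes
  (RProj_computes (@Ordinal 3 1 isT))) => g gP /=.
rewrite theadE; set P := prim_graph _ _.
suff H k : P k (2 ^ k * y.*2.+1) by [].
elim: k => [|k IH]; first by rewrite mul1n; apply: fP.
by exists (2 ^ k * y.*2.+1) => //; rewrite expnS -mulnA mul2n; apply: gP.
Qed.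

Definition computable n (F : n.-tuple nat -> nat) := exists f, @computes n f F.

Lemma computable_const n k : computable (fun _ : n.-tuple nat => k).
Proof. by exists (RConst n k); apply: RConst_computes. Qed.

Lemma computable_tnth n (i : 'I_n) : computable (fun v => tnth v i).
Proof. by exists (RProj i). Qed.

(* [CodeSeq.code (x :: s)] is [2 ^ x * (CodeSeq.code s).*2.+1]. *)
Lemma computable_code_cons n (A B : n.-tuple nat -> nat) :
  computable A -> computable B -> computable (fun v => 2 ^ A v * (B v).*2.+1).
Proof.
move=> [a aA] [b bB]; exists (RComp2 RCons a b).
exact: (RComp2_computes RCons_computes aA bB).
Qed.

(** * Derivations of evaluation facts *)

(* A fact of kind [KFun f] has registers [y, v_1, ..., v_n] and states that
   [rec_eval f v y].  A fact of kind [KAux f] has registers [k, v_1, ..., v_n]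
   and states that [f] is defined and positive at [(i, v)] for all [i < k]. *)
Inductive kind : Type := KFun n of recfun n | KAux n of recfun n.+1.

HB.instance Definition _ := gen_eqMixin kind.
HB.instance Definition _ := gen_choiceMixin kind.

Definition has_arguments (r : nat -> nat) n (v : n.-tuple nat) :=
  forall i, i < n -> nth 0 v i = r i.+1.

Definition kind_holds (K : kind) (r : nat -> nat) : Prop :=
  match K with
  | KFun n f => forall v, has_arguments r v -> rec_eval f v (r 0)
  | KAux n f => forall v, has_arguments r v ->
      forall i, i < r 0 -> exists z, rec_eval f [tuple of i :: v] z.+1
  end.

(** Every kind that a derivation of a fact about [f] can involve; the list is finite, so its rules
    form a TBox. *)
Fixpoint kinds n (f : recfun n) : seq kind :=
  KFun f :: match f with
  | RComp _ _ f g => kinds f ++ flatten [seq kinds (g i) | i : 'I__]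
  | RPrim _ f g => kinds f ++ kinds g
  | RMu _ f => KAux f :: kinds f
  | _ => [::]
  end.

(* Conditions on a fact, at address 0, and on the facts at the other addresses
   that support it: [x] is an address and [i] a register. *)
Inductive literal :=
| LKind (x : nat) (K : kind)
| LZero (x i : nat)
| LPos (x i : nat)
| LEq (x i c x' i' : nat).

Definition literal_holds (k : nat -> kind -> Prop) (r : nat -> nat -> nat) l :=
  match l with
  | LKind x K => k x K
  | LZero x i => r x i = 0
  | LPos x i => 0 < r x i
  | LEq x i c x' i' => r x i = c + r x' i'
  end.

Definition all_hold k r (ls : seq literal) :=
  foldr (fun l => and (literal_holds k r l)) True ls.

Definition copy_eqs x a x' b n : seq literal :=
  [seq LEq x (a + i) 0 x' (b + i) | i <- iota 0 n].

(* The pair (guard, body) in [rules K]: if a fact of kind [K] satisfies the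
   guard, it satisfies the body. *)
Definition rules (K : kind) : seq (seq literal * seq literal) :=
  match K with
  | KFun _ h =>
    match h with
    | RZero _ => [:: ([::], [:: LZero 0 0])]
    | RSucc => [:: ([::], [:: LEq 0 0 1 0 1])]
    | RProj _ i => [:: ([::], [:: LEq 0 0 0 0 i.+1])]
    | RComp n m f g =>
        [:: ([::],
             [:: LKind 1 (KFun f), LEq 1 0 0 0 0 &
              flatten [seq [:: LKind j.+2 (KFun (g j)), LEq 1 j.+1 0 j.+2 0 &
                            copy_eqs j.+2 1 0 1 n] | j : 'I_m]])]
    | RPrim n f g =>
        [:: ([:: LZero 0 1],
             [:: LKind 1 (KFun f), LEq 1 0 0 0 0 & copy_eqs 1 1 0 2 n]);
            ([:: LPos 0 1],
             [:: LKind 1 K, LEq 0 1 1 1 1, LKind 2 (KFun g), LEq 2 0 0 0 0,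
                 LEq 2 1 0 1 1, LEq 2 2 0 1 0 &
                 copy_eqs 1 2 0 2 n ++ copy_eqs 2 3 0 2 n])]
    | RMu n f =>
        [:: ([::],
             [:: LKind 1 (KAux f), LEq 1 0 0 0 0, LKind 2 (KFun f), LZero 2 0,
                 LEq 2 1 0 0 0 & copy_eqs 1 1 0 1 n ++ copy_eqs 2 2 0 1 n])]
    end
  | KAux n f =>
      [:: ([:: LPos 0 0],
           [:: LKind 1 K, LEq 0 0 1 1 0, LKind 2 (KFun f), LPos 2 0,
               LEq 2 1 0 1 0 & copy_eqs 1 1 0 1 n ++ copy_eqs 2 2 0 1 n])]
  end.

Definition rules_hold k r K :=
  k 0 K ->
  foldr (fun R => and (all_hold k r R.1 -> all_hold k r R.2)) True (rules K).

Lemma all_hold_cat k r ls ls' :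
  all_hold k r (ls ++ ls') <-> all_hold k r ls /\ all_hold k r ls'.
Proof. by elim: ls => [|l ls IH] /=; tauto. Qed.

Lemma all_hold_copy_eqs k r x a x' b n :
  all_hold k r (copy_eqs x a x' b n) <->
  forall i, i < n -> r x (a + i) = r x' (b + i).
Proof.
rewrite /copy_eqs.
have -> : (forall i, i < n -> r x (a + i) = r x' (b + i)) <->
    {in iota 0 n, forall i, r x (a + i) = r x' (b + i)}.
  by split=> H i; have := H i; rewrite mem_iota.
elim: (iota 0 n) => [|i s IH] //=; rewrite IH; split=> [[H1 H2] j|H].
  by rewrite inE => /predU1P[-> //|/H2].
by split=> [|j js]; apply: H; rewrite inE ?eqxx ?js ?orbT.
Qed.

Lemma all_hold_flatten k r m (F : 'I_m -> seq literal) :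
  all_hold k r (flatten [seq F j | j : 'I_m]) <-> forall j, all_hold k r (F j).
Proof.
have -> : (forall j, all_hold k r (F j)) <->
    {in enum 'I_m, forall j, all_hold k r (F j)}.
  by split=> H j; have := H j; rewrite mem_enum //; apply.
rewrite /image_mem; elim: (enum _) => [|i s IH] //=; rewrite all_hold_cat IH.
split=> [[H1 H2] j|H]; first by rewrite inE => /predU1P[-> //|/H2].
by split=> [|j js]; apply: H; rewrite inE ?eqxx ?js ?orbT.
Qed.

Lemma all_hold_mono (k k' : nat -> kind -> Prop) r ls :
  (forall x K, k x K -> k' x K) -> all_hold k r ls -> all_hold k' r ls.
Proof.
move=> kk'; elim: ls => [|l ls IH] //= [ll /IH]; split=> //.
by case: l ll => //= x K /kk'.
Qed.

(** Guards test registers only, and kinds occur positively in bodies, so a larger kind relation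
    still satisfies the rules. This serves for kinds that a model shows only through their names. *)
Lemma rules_hold_mono (k k' : nat -> kind -> Prop) r K :
    (forall x K', k x K' -> k' x K') -> (k' 0 K -> k 0 K) ->
  rules_hold k r K -> rules_hold k' r K.
Proof.
move=> kk' k'k RK /k'k /RK {RK}; have M ls := @all_hold_mono _ _ r ls kk'.
case: K k'k => [n [n'||n' i|n' m f g|n' f g|n' f]|n f] k'k.
all: rewrite /rules /foldr /fst /snd.
all: by do ?[case=> H B; split; [move=> h; apply: M; exact: (H h)|move: B {H}]].
Qed.

(** * Soundness of the rules *)

Section Soundness.
Variables (X : Type) (k : X -> nat -> kind -> Prop).
Variable r : X -> nat -> nat -> nat.
Hypothesis deref : forall d x K, k d x K -> exists2 e, k e 0 K & r d x = r e 0.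

Lemma deref_holds K : (forall d, k d 0 K -> kind_holds K (r d 0)) ->
  forall d x, k d x K -> kind_holds K (r d x).
Proof. by move=> H d x /deref[e /H eK ->]. Qed.

(* Induction on [f] and, for [RPrim] and [KAux], on register 1 or 0. *)
Lemma rec_eval_of_kind n (f : recfun n) :
    (forall K, K \in kinds f -> forall d, rules_hold (k d) (r d) K) ->
  forall d, k d 0 (KFun f) -> kind_holds (KFun f) (r d 0).
Proof.
elim: f => {n} [n||n i|n m f IHf g IHg|n f IHf g IHg|n f IHf] RK d kd v vr.
all: have := RK _ (mem_head _ _) _ kd; rewrite /=.
- by case=> /(_ I) [].
- by case=> /(_ I) [-> _] _; rewrite /thead (tnth_nth 0) vr.
- by case=> /(_ I) [-> _] _; rewrite (tnth_nth 0) vr.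
- case=> /(_ I) [kf] [ry] /all_hold_flatten kg _.
  have Rf K : K \in kinds f -> forall d, rules_hold (k d) (r d) K.
    by move=> Kf; apply: RK; rewrite /= inE mem_cat Kf orbT.
  exists [tuple r d 1 j.+1 | j < m].
    move=> j; have [kj [rj /all_hold_copy_eqs ra]] := kg j.
    have Rj K : K \in kinds (g j) -> forall d, rules_hold (k d) (r d) K.
      move=> Kg; apply: RK; rewrite /= inE mem_cat; apply/orP; right.
      apply/orP; right; apply/flattenP; exists (kinds (g j)) => //.
      by apply/mapP; exists j; rewrite ?mem_enum.
    rewrite tnth_mktuple rj; apply: (deref_holds (IHg j Rj) kj) => i ltin.
    by rewrite vr // -ra.
  rewrite -[r d 0 0]add0n -ry; apply: (deref_holds (IHf Rf) kf) => i ltin.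
  by rewrite -[i]/(val (Ordinal ltin)) -tnth_nth tnth_mktuple.
- move=> _; rewrite {1}/thead (tnth_nth 0) vr //.
  have Rf K : K \in kinds f -> forall d, rules_hold (k d) (r d) K.
    by move=> Kf; apply: RK; rewrite /= inE mem_cat Kf orbT.
  have Rg K : K \in kinds g -> forall d, rules_hold (k d) (r d) K.
    by move=> Kg; apply: RK; rewrite /= inE mem_cat Kg !orbT.
  have {}vr i : i < n -> nth 0 v i.+1 = r d 0 i.+2 by move=> ltin; rewrite vr.
  (* The predecessor facts share the parameters in [v], so the induction on register 1 ranges over
     all facts [d] with these parameters. *)
  move: vr; move E: (r d 0 1) => c; elim: c d kd E => [|c IHc] d kd E vr /=.
    have /= [/(_ (conj E I)) + _] := RK _ (mem_head _ _) _ kd.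
    case=> kf [ry /all_hold_copy_eqs ra]; rewrite -[r d 0 0]add0n -ry.
    apply: (deref_holds (IHf Rf) kf) => i ltin.
    by rewrite nth_behead vr // -ra.
  have /= [_ []] := RK _ (mem_head _ _) _ kd.
  rewrite E !add0n add1n; case=> // kp [[pE] [kg [gy [g1 [g2]]]]].
  rewrite all_hold_cat !all_hold_copy_eqs => -[rp rg] _.
  exists (r d 1 0).
    have [e ke re] := deref kp; rewrite re.
    apply: IHc; rewrite -?re // => i ltin.
    by rewrite vr // -rp.
  have := deref_holds (IHg Rg) kg; rewrite /= gy; apply=> -[|[|i]] ltin /=.
  - by rewrite g1 pE.
  - by rewrite g2.
  - by rewrite nth_behead vr // -rg.
- case=> /(_ I); rewrite !add0n => -[ka [ay [kf [f0 [f1]]]]] + _.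
  rewrite all_hold_cat !all_hold_copy_eqs => -[ra rf].
  have Rf K : K \in kinds f -> forall d, rules_hold (k d) (r d) K.
    by move=> Kf; apply: RK; rewrite /= !inE Kf !orbT.
  split.
    have := deref_holds (IHf Rf) kf; rewrite /= f0; apply=> -[|i] ltin //=.
    by rewrite vr // -rf.
  move=> i; rewrite -ay; have [e ke re] := deref ka.
  have {}vr j : j < n -> nth 0 v j = r e 0 j.+1.
    by move=> ltjn; rewrite vr // -re -ra.
  rewrite re; move E: (r e 0 0) => c {re ay}.
  elim: c e ke vr E i => [//|c IHc] e ke vr E i.
  have /= [] := RK (KAux f) _ _ ke; first by rewrite !inE eqxx orbT.
  rewrite E !add0n add1n; case=> // kp [[pE] [kg [g0 [g1]]]].
  rewrite all_hold_cat !all_hold_copy_eqs => -[rp rg] _.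
  rewrite ltnS leq_eqVlt => /predU1P[->|].
    exists (r e 2 0).-1; rewrite prednK //.
    apply: (deref_holds (IHf Rf) kg) => -[|j] ltjn /=; first by rewrite g1 pE.
    by rewrite vr // -rg.
  have [e' ke' re'] := deref kp; apply: (IHc e'); rewrite -?re' // => j ltjn.
  by rewrite vr // -rp.
Qed.
End Soundness.

(** * Completeness of the rules: finite supported sets of facts *)

Definition fact := (kind * seq nat)%type.

Definition address_kind (p : nat -> fact) x K := (p x).1 = K.
Definition address_reg (p : nat -> fact) x i := nth 0 (p x).2 i.

Definition supported_by (p : nat -> fact) :=
  rules_hold (address_kind p) (address_reg p) (p 0).1.

(* Circular support is allowed, as the model only needs each fact in it to be
   locally justified. *)
Definition supported_set (s : seq fact) := forall a, a \in s ->
  exists p, [/\ p 0 = a, supported_by p & forall x, p x \in s].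

Definition derivable (a : fact) := exists2 s, supported_set s & a \in s.

Lemma supported_set_cat s t :
  supported_set s -> supported_set t -> supported_set (s ++ t).
Proof.
move=> cs ct a; rewrite mem_cat => /orP[/cs|/ct] [p [p0 sp ps]]; exists p.
all: by split=> // x; rewrite mem_cat ps ?orbT.
Qed.

(** Supported sets are closed under union, so those of the premises combine and [a] can be added.
    The premises sit at addresses 1, 2, ...; all later addresses default to [a], which keeps them
    inside the set. *)
Lemma derivable_step a (s : seq fact) :
    (forall b, b \in s -> derivable b) -> supported_by (nth a (a :: s)) ->
  derivable a.
Proof.
move=> ds sa; suff [t ct st] : exists2 t, supported_set t & {subset s <= t}.
  exists (a :: t); last exact: mem_head.
  move=> b; rewrite inE => /predU1P[->|/ct [p [p0 sp pt]]]; last first.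
    by exists p; split=> // x; rewrite inE pt orbT.
  exists (nth a (a :: s)); split=> // -[|x]; first exact: mem_head.
  have [xs|sx] := ltnP x (size s); last by rewrite nth_default ?mem_head.
  by rewrite inE /= st ?orbT // mem_nth.
elim: s ds {sa} => [|b s IH] ds; first by exists [::].
have [b' b's|t ct st] := IH _; first by apply: ds; rewrite inE b's orbT.
have [u cu bu] := ds b (mem_head _ _).
exists (u ++ t); first exact: supported_set_cat.
by move=> b'; rewrite inE mem_cat => /predU1P[->|/st ->]; rewrite ?bu ?orbT.
Qed.

Lemma derivable_rec_eval n (f : recfun n) v y :
  rec_eval f v y -> derivable (KFun f, y :: v).
Proof.
elim: f v y => {n} [n||n i|n m f IHf g IHg|n f IHf g IHg|n f IHf] v y /=.
- by move=> ->; apply: (@derivable_step _ [::]) => // _; split.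
- move=> ->; apply: (@derivable_step _ [::]) => // _; split=> // _.
  by rewrite /= /thead (tnth_nth 0).
- move=> ->; apply: (@derivable_step _ [::]) => // _; split=> // _.
  by rewrite /= (tnth_nth 0).
- case=> w gw fw.
  apply: (@derivable_step _ ((KFun f, y :: w) ::
      [seq (KFun (g j), tnth w j :: v) | j : 'I_m])).
    move=> b; rewrite inE => /predU1P[->|/mapP[j _ ->]]; first exact: IHf.
    exact: IHg (gw j).
  move=> _; split=> // _; split=> //; split=> //; apply/all_hold_flatten => j.
  set p := nth _ _; have pj : p j.+2 = (KFun (g j), tnth w j :: v).
    by rewrite /p /= (nth_map j) ?size_enum_ord // nth_ord_enum.
  split; first by rewrite /= /address_kind pj.
  split; first by rewrite /= /address_reg pj /= add0n (tnth_nth 0).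
  by apply/all_hold_copy_eqs => i ltin; rewrite /address_reg pj.
- move: v y; suff H (c : nat) (v : n.+1.-tuple nat) (y : nat) :
      prim_graph (rec_eval f [tuple of behead v])
      (fun k z => rec_eval g [tuple of [:: k, z & behead v]]) c y ->
      derivable (KFun (RPrim f g), [:: y, c & behead v]).
    by move=> v y /H; case/tupleP: v => x v; rewrite theadE.
  elim: c y => [|c IHc] y /=.
    move=> /IHf fy; apply: (@derivable_step _ [:: (KFun f, y :: behead v)]).
      by move=> b; rewrite inE => /eqP ->.
    move=> _; split; last by split=> // -[].
    by move=> _; do 2!split=> //; apply/all_hold_copy_eqs.
  case=> z /IHc pz /IHg gy; apply: (@derivable_step _
    [:: (KFun (RPrim f g), [:: z, c & behead v]);
        (KFun g, [:: y, c, z & behead v])]).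
    by move=> b; rewrite !inE => /pred2P[] ->.
  move=> _; split; first by case.
  split=> // _; do 6!split=> //.
  by rewrite all_hold_cat !all_hold_copy_eqs.
- case=> fy lty.
  (* [KAux] facts are derived upward from count 0, where the guard fails and no premise is
     required. *)
  have aux c : c <= y -> derivable (KAux f, c :: v).
    elim: c => [|c IHc] ltcy.
      by apply: (@derivable_step _ [::]) => // _; split=> // -[].
    have [z fz] := lty c ltcy; apply: (@derivable_step _
      [:: (KAux f, c :: v); (KFun f, [:: z.+1, c & v])]).
      move=> b; rewrite !inE => /pred2P[] ->; first exact/IHc/ltnW.
      exact: (IHf _ _ fz).
    move=> _; split=> // _; do 5!split=> //.
    by rewrite all_hold_cat !all_hold_copy_eqs.
  apply: (@derivable_step _ [:: (KAux f, y :: v); (KFun f, [:: 0, y & v])]).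
    by move=> b; rewrite !inE => /pred2P[] ->; [apply: aux|apply: (IHf _ _ fy)].
  move=> _; split=> // _; do 5!split=> //.
  by rewrite all_hold_cat !all_hold_copy_eqs.
Qed.

(** * Definedness of features *)

Lemma infinite_set_injection T (A : set T) :
  infinite_set A -> exists2 f : nat -> T, injective f & forall n, A (f n).
Proof.
elim/Ppointed: T => T in A *.
  by rewrite emptyE => /infinite_setN0 [].
move=> /infiniteP/ppcard_leP[f]; exists f; first exact: injT.
by move=> n; apply: (@funS _ _ _ _ f).
Qed.

Section Position.
Variable D : concrete_domain.

Definition position_values (P : pred_name D) (j : 'I_(arity P)) :
    set (cd_dom D) := [set a | exists2 t, cd_rel t & tnth t j = a]%classic.

(* A formula cannot separate values that occur in no true atom. *)
Lemma qf_holds_cofinite V (phi : qf_formula D V) :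
    (forall P (j : 'I_(arity P)), finite_set (position_values j)) ->
  exists2 B : set (cd_dom D), finite_set B &
    forall v v', (forall x, ~ B (v x)) -> (forall x, ~ B (v' x)) ->
      qf_holds v phi <-> qf_holds v' phi.
Proof.
have avoidU (W : Type) (B C : set (cd_dom D)) (v : W -> cd_dom D) :
    (forall x, ~ (B `|` C)%classic (v x)) ->
    (forall x, ~ B (v x)) /\ (forall x, ~ C (v x)).
  by move=> BCv; split=> x vx; apply: (BCv x); [left|right].
move=> fin.
elim: phi => [P t|p [B Bf Bp]|p [B Bf Bp] q [C Cf Cq]|p [B Bf Bp] q [C Cf Cq]].
- exists (\bigcup_j @position_values P j)%classic.
    by apply: bigcup_finite => [|j _] //; apply: finite_finset.
  have imp v v' :
      (forall x, ~ (\bigcup_j @position_values P j)%classic (v x)) ->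
      cd_rel [tuple of map v t] -> cd_rel [tuple of map v' t].
    (* Any position of [t] would put a value of [v] into the avoided set, so there is none and both
       tuples are empty. *)
    move=> vB vt; suff <- : [tuple of map v t] = [tuple of map v' t] by [].
    apply: eq_from_tnth => i; case: (vB (tnth t i)); exists i => //.
    by exists [tuple of map v t]; rewrite ?tnth_map.
  by move=> v v' vB v'B; split; apply: imp.
- by exists B => // v v' vB v'B /=; rewrite (Bp v v').
all: exists (B `|` C)%classic; first by rewrite finite_setU.
all: move=> v v' /avoidU[vB vC] /avoidU[v'B v'C] /=.
all: by rewrite (Bp v v') ?(Cq v v').
Qed.

(** Otherwise the truth value of [phi] is constant off a finite set. Two distinct values [a] and [b]
    remain there, and [phi] at [a, a] would force [a = b]. The tuples [c n] later represent the
    numbers [n]. *)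
Lemma exists_infinite_position : infinite_domain D -> JD D ->
  exists P (j : 'I_(arity P)) (c : nat -> (arity P).-tuple (cd_dom D)),
    (forall n, cd_rel (c n)) /\ injective (fun n => tnth (c n) j).
Proof.
move=> Dinf [phi phiP]; apply: contrapT => no.
have fin P (j : 'I_(arity P)) : finite_set (position_values j).
  apply: contrapT => /infinite_set_injection [f fI fP]; apply: no; exists P, j.
  have /choice [c cP] n : exists t : (arity P).-tuple (cd_dom D),
      cd_rel t /\ tnth t j = f n.
    by have [t tP tj] := fP n; exists t.
  exists c; split=> [n|n n' /=]; first by case: (cP n).
  by rewrite !(proj2 (cP _)) => /fI.
have [B Bf Bphi] := qf_holds_cofinite phi fin.
have Binf := infinite_setD Dinf Bf.
have [a [_ aB]] := infinite_setN0 Binf.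
have [b [[_ bB] ba]] := infinite_setN0 (infinite_setD Binf (finite_set1 a)).
apply: ba => /=; apply/esym/phiP.
apply/(Bphi (tnth [tuple a; a])); try by case=> -[|[|[]]].
by apply/phiP.
Qed.
End Position.

(** * The encoding TBox *)

Section Encoding.
Variables (D : concrete_domain) (phi : qf_formula D 'I_2).
Hypothesis phiP :
  forall a b : cd_dom D, qf_holds (tnth [tuple a; b]) phi <-> a = b.
Variables (P : pred_name D) (j : 'I_(arity P)).

(* Nothing in the language says that a feature is defined, and the negations in
   [phi] also hold of undefined features.  So an abstract feature [f] is split
   into [arity P] concrete features, its value is the [j]-th one, and it counts
   only if they form a tuple in [P]. *)
Definition component f (i : 'I_(arity P)) : feature_name := f * arity P + i.

Definition guard_term (mk : feature_name -> feature_arg) f : set_term D :=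
  TFeature P [tuple mk (component f i) | i < arity P].

Fixpoint qf_term V (w : V -> feature_arg) (psi : qf_formula D V) : set_term D :=
  match psi with
  | QAtom Q t => TFeature Q [tuple of map w t]
  | QNot p => TCompl (qf_term w p)
  | QAnd p q => TCap (qf_term w p) (qf_term w q)
  | QOr p q => TCup (qf_term w p) (qf_term w q)
  end.

Definition same_term f g : set_term D :=
  TCap (TCap (guard_term FNext f) (guard_term FOwn g))
    (qf_term (tnth [tuple FNext (component f j); FOwn (component g j)]) phi).

Section Interp.
Variable I : interpretation D.
Implicit Types d e : idom I.

Definition guarded_value f d a := exists t : (arity P).-tuple (cd_dom D),
  [/\ forall i, ifeature (component f i) d = Some (tnth t i), cd_rel t &
      tnth t j = a].

Lemma guarded_value_det f d a b :
  guarded_value f d a -> guarded_value f d b -> a = b.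
Proof.
by move=> [t [tf _ <-]] [u [uf _ <-]]; have := tf j; rewrite uf => -[].
Qed.

Lemma qf_termP V (w : V -> feature_arg) (v : V -> cd_dom D) psi d e :
    (forall x, arg_value d e (w x) = Some (v x)) ->
  (e \in set_term_val (qf_term w psi) d) <-> qf_holds v psi.
Proof.
move=> wv; elim: psi => [Q t|p IH|p IHp q IHq|p IHp q IHq] /=.
- rewrite inE asboolE; split=> [[c [ct cQ]]|vt].
    suff <- : c = [tuple of map v t] by [].
    by apply: eq_from_tnth => i; have := ct i; rewrite !tnth_map wv => -[].
  by exists [tuple of map v t]; split=> // i; rewrite !tnth_map wv.
- by rewrite inE -IH; split=> /negP.
- by rewrite inE -IHp -IHq; split=> /andP.
- by rewrite inE -IHp -IHq; split=> /orP.
Qed.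

Lemma in_same_term f g d e : (e \in set_term_val (same_term f g) d) <->
  exists a, guarded_value f e a /\ guarded_value g d a.
Proof.
have gP mk h x : (forall k, arg_value d e (mk k) = ifeature k x) ->
    (e \in set_term_val (guard_term mk h) d) <-> exists a, guarded_value h x a.
  move=> mkx; rewrite /= inE asboolE; split=> [[c [cE cP]]|[_ [c [cE cP _]]]].
    by exists (tnth c j), c; split=> // i; rewrite -cE tnth_mktuple mkx.
  by exists c; split=> // i; rewrite -cE tnth_mktuple mkx.
have eqP a b : guarded_value f e a -> guarded_value g d b ->
    (e \in set_term_val (qf_term
      (tnth [tuple FNext (component f j); FOwn (component g j)]) phi) d) <->
    a = b.
  move=> [t [tf _ <-]] [u [uf _ <-]]; rewrite -phiP; apply: qf_termP.
  by case=> -[|[|//]] i2; [apply: (tf j)|apply: (uf j)].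
rewrite -[same_term f g]/(TCap (TCap _ _) _) [set_term_val _ _]/= 2!in_setI.
split=> [/andP[/andP[/(gP FNext _ _ (fun=> erefl)) [a fa]
    /(gP FOwn _ _ (fun=> erefl)) [b gb]] /(eqP a b fa gb) ab]|[a [fa ga]]].
  by exists a; split; rewrite // ab.
apply/andP; split; last exact/(eqP a a).
by apply/andP; split; [apply/(gP FNext)|apply/(gP FOwn)]; try exists a.
Qed.

(** The set depends on the key alone, so an element reads the registers of a premise by holding the
    key of that premise. *)
Lemma eq_same_term_val f g g' d e a :
    guarded_value g d a -> guarded_value g' e a ->
  set_term_val (same_term f g) d = set_term_val (same_term f g') e.
Proof.
move=> da ea; apply/setP => x.
apply/idP/idP => /in_same_term [b [xb gb]].
all: apply/in_same_term; exists b; split=> //.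
  by rewrite (guarded_value_det gb da).
by rewrite (guarded_value_det gb ea).
Qed.

End Interp.

Definition card_expr (s : set_term D) := PAdd 1 s (PConst 0).

Definition inhabited_con (s : set_term D) := KLt (PConst 0) (card_expr s).

Definition CTop : concept D := CSat (KSub TEmpty TEmpty).

(* [link_feature 0] is the key of an element, [link_feature x] the key of the
   fact it finds at address [x], and [root_feature] the key of the fact whose
   register 1 is the input. *)
Definition root_feature : nat := 0.
Definition link_feature x := x.*2.+1.
Definition owner_feature i := i.*2.+2.

Variable kname : kind -> concept_name.

Definition register x i := same_term (owner_feature i) (link_feature x).

Definition literal_constraint l : constraint D :=
  match l with
  | LKind x K =>
      inhabited_con (TCap (same_term (link_feature 0) (link_feature x))
                          (TConcept (CName (kname K))))
  | LZero x i => KEq (card_expr (register x i)) (PConst 0)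
  | LPos x i => inhabited_con (register x i)
  | LEq x i c x' i' =>
      KEq (card_expr (register x i)) (PAdd 1 (register x' i') (PConst c))
  end.

Definition conjunction (ls : seq literal) : concept D :=
  foldr (fun l => CAnd (CSat (literal_constraint l))) CTop ls.

Definition rule_inclusions K : tbox D :=
  [seq (CAnd (conjunction [:: LKind 0 K]) (conjunction R.1), conjunction R.2)
  | R <- rules K].

Definition root_inclusion K : concept D * concept D :=
  (CTop, CSat (inhabited_con (TCap (same_term (link_feature 0) root_feature)
                                   (TConcept (CName (kname K)))))).

Definition input_inclusion n : concept D * concept D :=
  (CTop, CSat (KEq (card_expr (same_term (owner_feature 1) root_feature))
                   (PConst n))).

Definition program (h : recfun 1) : tbox D :=
  root_inclusion (KFun h) :: flatten [seq rule_inclusions K | K <- kinds h].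

(** * Soundness: reading facts off a model *)

Section Reading.
Variable I : interpretation D.
Implicit Types d e : idom I.

Definition kind_at d x K := constraint_sat (literal_constraint (LKind x K)) d.
Definition register_at d x i := #|set_term_val (register x i) d|.

Lemma is_model_cons ci (T : tbox D) : is_model I (ci :: T) =
  (concept_int I ci.1 \subset concept_int I ci.2) && is_model I T.
Proof. by []. Qed.

Lemma in_CSat k d : (d \in concept_int I (CSat k)) = constraint_sat k d.
Proof. by rewrite in_set. Qed.

Lemma inhabited_conP s d :
  reflect (exists e, e \in set_term_val s d)
    (constraint_sat (inhabited_con s) d).
Proof. by rewrite /= mul1n addn0; apply: card_gt0P. Qed.

Lemma literal_constraintP l d :
  constraint_sat (literal_constraint l) d <->
  literal_holds (kind_at d) (register_at d) l.
Proof.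
case: l => [x K|x i|x i|x i c x' i'] //.
- by split=> [/eqP|E]; last apply/eqP; rewrite /= mul1n addn0.
- by rewrite /inhabited_con /= mul1n addn0.
- split=> [/eqP|E]; last apply/eqP; rewrite /= !mul1n !addn0 1?addnC //.
Qed.

Lemma in_conjunction ls d :
  d \in concept_int I (conjunction ls) <->
  all_hold (kind_at d) (register_at d) ls.
Proof.
elim: ls => [|l ls IH]; first by rewrite /= inE sub0set.
rewrite [concept_int _ _]/= [all_hold _ _ _]/= inE -literal_constraintP -IH inE.
by split=> /andP.
Qed.

Lemma rule_inclusionsP K :
  is_model I (rule_inclusions K) <->
  forall d, rules_hold (kind_at d) (register_at d) K.
Proof.
have intE C1 C2 :
  concept_int I (CAnd C1 C2) = concept_int I C1 :&: concept_int I C2 by [].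
have ruleP (R : seq literal * seq literal) :
    (concept_int I (CAnd (conjunction [:: LKind 0 K]) (conjunction R.1))
       \subset concept_int I (conjunction R.2)) <->
    forall d, kind_at d 0 K -> all_hold (kind_at d) (register_at d) R.1 ->
      all_hold (kind_at d) (register_at d) R.2.
  split=> [/fintype.subsetP sub d kd /in_conjunction Rd|H].
    apply/in_conjunction/sub; rewrite intE in_setI Rd andbT.
    by apply/in_conjunction.
  apply/fintype.subsetP => d; rewrite intE in_setI => /andP[].
  by move=> /in_conjunction[kd _] /in_conjunction/(H d kd)/in_conjunction.
rewrite /rules_hold /is_model /rule_inclusions.
elim: (rules K) => [|R Rs IH] //.
rewrite [all _ _]/=.
split=> [/andP[/ruleP HR /IH HRs] d kd|H].
  by split; [exact: HR|exact: HRs].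
by apply/andP; split; [apply/ruleP|apply/IH] => d /H [].
Qed.

Lemma kind_atP d x K :
  kind_at d x K <-> exists e, e \in iconcept I (kname K) /\
    exists a, guarded_value (link_feature 0) e a /\
              guarded_value (link_feature x) d a.
Proof.
rewrite /kind_at /literal_constraint.
split=> [/inhabited_conP [e /setIP [/in_same_term ea eK]]|[e [eK ea]]].
  by exists e.
by apply/inhabited_conP; exists e; apply/setIP; split=> //; apply/in_same_term.
Qed.

Lemma deref d x K :
  kind_at d x K -> exists2 e, kind_at e 0 K & register_at d x = register_at e 0.
Proof.
move=> /kind_atP [e [eK [a [ea da]]]]; exists e.
  by apply/kind_atP; exists e; split=> //; exists a.
by apply/funext => i; rewrite /register_at (eq_same_term_val _ da ea).
Qed.

Lemma program_inclusionsP (s : seq kind) :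
  is_model I (flatten [seq rule_inclusions K | K <- s]) <->
  {in s, forall K d, rules_hold (kind_at d) (register_at d) K}.
Proof.
rewrite /is_model; elim: s => [|K s IH] //; rewrite /= all_cat.
split=> [/andP[/rule_inclusionsP HK /IH Hs] K'|H].
  by rewrite inE => /predU1P[-> //|/Hs].
apply/andP; split; first by apply/rule_inclusionsP/H/mem_head.
by apply/IH => K' K's; apply: H; rewrite inE K's orbT.
Qed.

(** Some element exists, and its root feature leads to a fact of kind [KFun h] whose register 1 is
    [n]; by soundness of the rules, register 0 of that fact is the value. *)
Lemma program_sound h n :
    is_model I (input_inclusion n :: program h) ->
  exists y, rec_eval h [tuple n] y.
Proof.
have /card_gt0P [d _] := idom_gt0 I.
have TopE k :
    concept_int I CTop \subset concept_int I (CSat k) -> constraint_sat k d.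
  move=> /fintype.subsetP sub; rewrite -in_CSat sub // in_CSat.
  exact: sub0set.
rewrite /program !is_model_cons.
move=> /and3P[/TopE + /TopE + /program_inclusionsP H].
move=> /eqP dn /inhabited_conP [e] /setIP [/in_same_term [a [ea da]] eK].
exists (register_at e 0 0).
have ke : kind_at e 0 (KFun h).
  by apply/kind_atP; exists e; split=> //; exists a.
apply: (rec_eval_of_kind deref _ ke) => [//|[|//] _ /=].
rewrite /register_at (eq_same_term_val _ ea da).
by move: dn; rewrite /= mul1n addn0.
Qed.

End Reading.

(** * Completeness: a model built from a derivation *)

Section Model.
Variable c : nat -> (arity P).-tuple (cd_dom D).
Hypothesis c_rel : forall n, cd_rel (c n).
Hypothesis c_inj : injective (fun n => tnth (c n) j).
Variables (X : finType) (X_gt0 : 0 < #|X|).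
Variables (A : concept_name -> {set X}) (V : nat -> X -> nat).

Lemma arity_gt0 : 0 < arity P. Proof. exact: leq_trans (ltn_ord j). Qed.

(** Inverse of [component]: the quotient is the abstract feature and the remainder the position. The
    number [V f x] is represented by the tuple [c (V f x)]. *)
Definition model : interpretation D :=
  @Interpretation D X X_gt0 A (fun _ _ _ => false)
    (fun f x => Some (tnth (c (V (f %/ arity P) x))
                           (Ordinal (ltn_pmod f arity_gt0)))).

Lemma model_guarded_value f (x : idom model) a :
  guarded_value f x a <-> a = tnth (c (V f x)) j.
Proof.
have cf i : ifeature (component f i) x = Some (tnth (c (V f x)) i).
  congr (Some (tnth (c (V _ x)) _)).
    by rewrite /component divnMDl ?arity_gt0 // divn_small ?addn0.
  by apply: val_inj; rewrite /= /component modnMDl modn_small.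
split=> [[t [tf _ <-]]|->]; last by exists (c (V f x)).
by have := tf j; rewrite cf => -[].
Qed.

Lemma model_same_term f g (x : idom model) :
  set_term_val (same_term f g) x = [set y : X | V f y == V g x].
Proof.
apply/setP => y; rewrite [in RHS]inE; apply/idP/eqP.
  by case/in_same_term => a [/model_guarded_value -> /model_guarded_value/c_inj].
move=> E; apply/in_same_term; exists (tnth (c (V g x)) j).
by rewrite !model_guarded_value E.
Qed.

End Model.

Lemma program_complete (c : nat -> (arity P).-tuple (cd_dom D)) h n :
    (forall k, cd_rel (c k)) -> injective (fun k => tnth (c k) j) ->
    {in kinds h, injective kname} -> (exists y, rec_eval h [tuple n] y) ->
  consistent (input_inclusion n :: program h).
Proof.
move=> c_rel c_inj name_inj [y /derivable_rec_eval [s cs rs]].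
have /choice [p pP] (a : seq_sub s) : exists p : nat -> fact,
    [/\ p 0 = ssval a, supported_by p & forall x, p x \in s].
  exact/cs/ssvalP.
(* A common bound on all registers tells how many owners each fact must be able to have. *)
have [Q regQ] : exists Q, forall a, a \in s -> forall i, nth 0 a.2 i <= Q.
  exists (\max_(m <- flatten [seq a.2 | a <- s]) m) => a sa i.
  have [ia|ai] := ltnP i (size a.2); last by rewrite nth_default.
  apply: (@leq_bigmax_seq _ _ xpredT id) => //; apply/flattenP.
  by exists a.2; [exact: map_f | exact: mem_nth].
(* The element (a, k) has the key of the fact [a], and is owned by [a] at
   register i iff k is smaller than that register. *)
pose X := (seq_sub s * 'I_Q.+1)%type.
pose r0 := SeqSub rs.
have X_gt0 : 0 < #|{: X}| by apply/card_gt0P; exists (r0, ord0).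
pose number (a : fact) := index a s.
(* The default [size s] is the index of no fact, so a non-owner is counted nowhere. *)
pose V f (x : X) :=
  if f == root_feature then number (ssval r0) else
  if odd f then number (p x.1 f./2) else
  if x.2 < nth 0 (ssval x.1).2 f./2.-1 then number (ssval x.1) else size s.
pose A q := [set x : X | kname (ssval x.1).1 == q].
pose I := model c X_gt0 A V.
have Vlink i x : V (link_feature i) x = number (p x.1 i).
  by rewrite /V /link_feature /= odd_double uphalf_double.
have Vowner i x : V (owner_feature i) x =
    if x.2 < nth 0 (ssval x.1).2 i then number (ssval x.1) else size s.
  by rewrite /V /owner_feature /= odd_double /= doubleK.
have num_inj a b : a \in s -> number a = number b -> a = b.
  move=> sa E.
  have sb : b \in s by rewrite -index_mem -/(number b) -E index_mem.
  by rewrite -(nth_index a sa) -/(number a) E nth_index.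
have count i f (d : X) b : b \in s -> V f d = number b ->
    #|set_term_val (same_term (owner_feature i) f) (d : idom I)| = nth 0 b.2 i.
  move=> sb fb; rewrite model_same_term // fb.
  have ltbQ : nth 0 b.2 i <= Q.+1 by apply: leqW; apply: regQ.
  rewrite -[RHS]card_ord.
  (* The owners are the pairs of [b] with a number below its register, an injective image of an
     ordinal of that size. *)
  rewrite -(card_imset _ (f := fun k => (SeqSub sb, widen_ord ltbQ k))).
    apply: eq_card => -[[e se] k]; rewrite !inE Vowner /=.
    apply/idP/imsetP => [|[k' _ [-> ->]] /=]; last by rewrite ltn_ord.
    case: ifP => [ltk /eqP/(num_inj _ _ se) eb|_ /eqP E]; last first.
      by have := sb; rewrite -index_mem -/(number b) -E ltnn.
    subst b; exists (Ordinal ltk) => //.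
    by congr (_, _); apply: val_inj.
  by move=> k k' [kk']; apply: val_inj.
have gv f (d : idom I) a : guarded_value f d a <-> a = tnth (c (V f d)) j.
  exact: model_guarded_value.
have kindE x K (d : idom I) : kind_at d x K <-> kname (p d.1 x).1 = kname K.
  have [_ _ ps] := pP d.1.
  split=> [/kind_atP [e [eK [a [/gv -> /gv/c_inj]]]]|dK].
    rewrite !Vlink.
    have [-> _ _] := pP e.1 => /(num_inj _ _ (ssvalP _)) <-.
    by move: eK; rewrite inE => /eqP.
  apply/kind_atP; exists (SeqSub (ps x), ord0).
  split; first by rewrite inE /= dK.
  exists (tnth (c (number (p d.1 x))) j); rewrite !gv !Vlink.
  by have [-> _ _] := pP (SeqSub (ps x)).
exists I; rewrite /program !is_model_cons; apply/and3P; split.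
- apply/fintype.subsetP => d _.
  by rewrite in_CSat /= mul1n addn0 (count 1 _ _ _ rs).
- apply/fintype.subsetP => d _; rewrite in_CSat; apply/inhabited_conP.
  exists (r0, ord0); apply/setIP; split; last by rewrite inE.
  apply/in_same_term; exists (tnth (c (V root_feature d)) j); rewrite !gv Vlink.
  by have [-> _ _] := pP r0.
- apply/program_inclusionsP => K Kh d kd.
  (* Names are injective on [kinds h], so [K] is the kind of the fact carried by [d], and the
     support of that fact gives the rules. *)
  have [p0 sp ps] := pP d.1; have pK : K = (p d.1 0).1.
    by apply: name_inj => //; apply/esym/kindE.
  rewrite pK in kd *; suff -> : register_at d = address_reg (p d.1).
    apply: rules_hold_mono sp kd => [x K'|//].
    by rewrite /address_kind => E; apply/kindE; rewrite E.
  by apply/funext => x; apply/funext => i; apply: count (ps x) _; rewrite Vlink.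
Qed.

End Encoding.

(** * Diagonalisation *)

Lemma computable_code n (s : seq (n.-tuple nat -> nat)) :
    foldr (fun F => and (computable F)) True s ->
  computable (fun v => CodeSeq.code [seq F v | F <- s]).
Proof.
elim: s => [_|F s IH [cF /IH]]; first exact: computable_const.
exact: computable_code_cons.
Qed.

(** The number [n] occurs once in the added inclusion, as a constant, and once as the code of the
    tail; all the rest is fixed. *)
Lemma computable_self_input (D : concrete_domain) (phi : qf_formula D 'I_2)
    (P : pred_name D) (j : 'I_(arity P)) :
  exists s : recfun 1, forall T : tbox D, let n := tbox_code T in
    rec_eval s [tuple n] (tbox_code (input_inclusion phi j n :: T)).
Proof.
pose k (m : nat) := fun _ : 1.-tuple nat => m.
have kc m : computable (k m) := computable_const 1 m.
pose arg v : nat := tnth v (@ord0 0).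
have argP : computable arg := computable_tnth ord0.
pose input := card_expr (same_term phi j (owner_feature 1) root_feature).
(* The codes are built outward: constant, equation, concept, inclusion. *)
have c0 := @computable_code _ [:: k 0; arg] (conj (kc 0) (conj argP I)).
have c1 := @computable_code _ [:: k 2; k (pa_expr_code input); _]
  (conj (kc 2) (conj (kc _) (conj c0 I))).
have c2 := @computable_code _ [:: k 4; _] (conj (kc 4) (conj c1 I)).
have c3 := @computable_code _ [:: k (concept_code (CTop D)); _]
  (conj (kc _) (conj c2 I)).
have [s sP] := computable_code_cons c3 argP.
by exists s => T; apply: sP.
Qed.

(** Search for a zero of a function with constant value [f (s n)]: value 0 stops the search at once,
    and value 1 never does, by determinism. *)
Lemma diagonal_recfun (f s : recfun 1) : exists h : recfun 1,
  forall n m, rec_eval s [tuple n] m ->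
    (rec_eval f [tuple m] 0 -> exists y, rec_eval h [tuple n] y) /\
    (rec_eval f [tuple m] 1 -> ~ exists y, rec_eval h [tuple n] y).
Proof.
(* Binary, but independent of the first argument, over which [RMu] searches. *)
pose fs : recfun 2 :=
  RComp f (fun=> RComp s (fun=> RProj (@Ordinal 2 1 isT))).
exists (RMu fs) => n m sm.
have eval z w :
    rec_eval f [tuple m] z -> rec_eval fs [tuple of w :: [tuple n]] z.
  move=> fz; exists [tuple m] => // i; rewrite (ord1 i).
  by exists [tuple n] => // k; rewrite (ord1 k).
split=> [f0|f1 [y [fy _]]]; first by exists 0; split=> //; apply: eval.
by have := @rec_eval_det _ fs _ _ _ fy (eval 1 y f1).
Qed.

Theorem theorem5 (D : concrete_domain) (D_infinite : infinite_domain D)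
    (D_jd : JD D) :
  undecidable (@tbox_code D) (@consistent D).
Proof.
move=> [f fP].
have [P [j [c [c_rel c_inj]]]] := exists_infinite_position D_infinite D_jd.
have [phi phiP] := D_jd; have [s sP] := computable_self_input phi j.
have [h hP] := diagonal_recfun f s.
(* Each kind is named by its index in [kinds h], which is injective on that list. *)
pose T := program phi j (index^~ (kinds h)) h.
pose U := input_inclusion phi j (tbox_code T) :: T.
have [halts loops] := hP _ _ (sP T); have [fU1 fU0] := fP U.
(* A model of [U] makes the decider answer 1, so [h] diverges on the code of [T], whereas soundness
   makes it halt there. *)
have U_inconsistent : ~ consistent U.
  by case=> I IU; apply: loops (program_sound phiP IU); apply: fU1; exists I.
(* Now the decider answers 0, so [h] halts on the code of [T], and completeness yields the model
   just excluded. *)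
apply: (U_inconsistent); apply: (program_complete phiP c_rel c_inj); last first.
  exact: halts (fU0 U_inconsistent).
move=> K Kh K' E; have K'h : K' \in kinds h by rewrite -index_mem -E index_mem.
by rewrite -(nth_index K Kh) E nth_index.
Qed.
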